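(* If $G$ is a WTD graph with minimum degree $\delta(G)\geq 3$, then its girth satisfies $g(G)\leq 12$.
   Context: Graphs are finite, simple and nonempty. A total dominating set (TDS) of a graph $G$ with no isolated vertices is a set $S\subseteq V(G)$ such that every vertex of $G$ is adjacent to at least one element of $S$; it is minimal if it contains no other TDS. $G$ is well-totally-dominated (WTD) if it has no isolated vertices and all its minimal TDSs have the same size. The girth $g(G)$ is the length of a shortest cycle of $G$. *)

(* Defs.v *)
From mathcomp Require Import all_boot.

Set Implicit Arguments.
Unset Strict Implicit.
Unset Printing Implicit Defensive.

(* A finite simple graph is given by its adjacency relation [e] on the finite
   vertex type [T], subject to [simple_graph e]. *)
Definition simple_graph (T : finType) (e : rel T) : Prop :=
  symmetric e /\ irreflexive e.

Definition degree (T : finType) (e : rel T) (x : T) : nat := #|[set y | e x y]|.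

(* Degrees never exceed #|T|, so the default #|T| does not affect the minimum
   when T is nonempty; see [min_degreeP]. *)
Definition min_degree (T : finType) (e : rel T) : nat :=
  \big[minn/#|T|]_(x : T) degree e x.

Definition no_isolated (T : finType) (e : rel T) : bool :=
  [forall x, exists y, e x y].

Definition total_dominating (T : finType) (e : rel T) (S : {set T}) : bool :=
  [forall x, exists y in S, e x y].

Definition minimal_total_dominating (T : finType) (e : rel T) (S : {set T}) :
    bool :=
  minset (total_dominating e) S.

Definition well_totally_dominated (T : finType) (e : rel T) : Prop :=
  no_isolated e /\
  forall S1 S2 : {set T},
    minimal_total_dominating e S1 -> minimal_total_dominating e S2 ->
    #|S1| = #|S2|.

(* A cycle is listed by its distinct vertices.  The bound on the size excludes
   the empty sequence and single edges, which [ucycleb] accepts. *)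
Definition graph_cycle (T : finType) (e : rel T) (c : seq T) : bool :=
  (2 < size c) && ucycleb e c.

Definition has_cycle_of_length (T : finType) (e : rel T) (k : nat) : bool :=
  [exists c : k.-tuple T, graph_cycle e c].

(* [None] stands for the infinite girth of an acyclic graph.  Cycle lengths
   are at most #|T|, so the search range is exhaustive. *)
Definition girth (T : finType) (e : rel T) : option nat :=
  ohead [seq k <- iota 0 #|T|.+1 | has_cycle_of_length e k].

Lemma min_degreeP (T : finType) (e : rel T) (d : nat) : 0 < #|T| ->
  d <= min_degree e <-> forall x, d <= degree e x.
Proof.
move=> T_gt0; rewrite /min_degree; split=> [le_d x | le_d].
  apply: leq_trans le_d _; elim: (index_enum T) (mem_index_enum x) => // y r IHr.
  rewrite inE big_cons geq_min => /predU1P[<- | /IHr ->]; last exact: orbT.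
  by rewrite leqnn.
elim/big_ind: _ => // [|m n le_m le_n]; last by rewrite leq_min le_m.
by case/card_gt0P: T_gt0 => x _; apply: leq_trans (le_d x) (max_card _).
Qed.

Lemma girthP (T : finType) (e : rel T) (g : nat) :
  girth e = Some g <->
  (exists2 c, graph_cycle e c & size c = g) /\
  (forall c, graph_cycle e c -> g <= size c).
Proof.
pose s := [seq k <- iota 0 #|T|.+1 | has_cycle_of_length e k].
have mem_s k : reflect (exists2 c, graph_cycle e c & size c = k) (k \in s).
  rewrite mem_filter mem_iota /= add0n ltnS; apply: (iffP andP) => [[] | [c cP <-]].
    by case/existsP=> c cP _; exists (val c); rewrite ?size_tuple.
  split; first by apply/existsP; exists (in_tuple c).
  by case/and3P: cP => _ _ /card_uniqP <-; apply: max_card.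
have sorted_s : sorted ltn s.
  by apply: sorted_filter (iota_ltn_sorted _ _); apply: ltn_trans.
rewrite /girth -/s; case: s mem_s sorted_s => [|k s] mem_s sorted_s /=.
  by split=> [// | [/mem_s]].
have min_k c : graph_cycle e c -> k <= size c.
  move=> cP; have /mem_s : exists2 c', graph_cycle e c' & size c' = size c.
    by exists c.
  rewrite inE => /predU1P[-> // | sc].
  by apply: ltnW; move: sorted_s => /= /(order_path_min ltn_trans)/allP; apply.
have /mem_s[c0 c0P c0k] : k \in k :: s by rewrite mem_head.
split=> [[<-] | [[c cP cg] min_g]]; first by split=> //; exists c0.
by congr Some; apply/eqP; rewrite eqn_leq -{1}cg min_k //= -c0k min_g.
Qed.

(* Main.v *)
Require Import Defs.
From mathcomp Require Import all_boot zify.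

(** Assume that there is no cycle of length at most 12 and take a path
    [a u b w c].  Let [I] consist of the neighbours of [u] other than [a], those
    of [w] other than [c], and, for every other neighbour [x] of [a] or [c], all
    neighbours but [y] of some [z], where [x y z] continues the path from [a] or
    [c] through [x].  No neighbourhood is contained in [I]: of three vertices of
    [I] adjacent to [v], two would be reached from the same end [a] or [c] by
    paths of length at most 4, closing a cycle of length at most 10.  Hence some
    minimal TDS [S] avoids [I], so it contains [a], [c] and every [y], but not
    [b].  Then replacing [a] and [c] by [b] gives a smaller TDS. *)

Set Implicit Arguments.
Unset Strict Implicit.
Unset Printing Implicit Defensive.

(** * Non-backtracking walks and cycles *)

Section NonBacktracking.

Variables (T : finType) (e : rel T).
Hypotheses (e_sym : symmetric e) (e_irr : irreflexive e).

(** Only an immediate return along the same edge is forbidden. This local condition survives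
    reversal and gluing along a common edge. *)
Fixpoint nbwalk (s : seq T) : bool :=
  if s is x :: s1 then
    if s1 is y :: s2 then
      [&& e x y, (if s2 is z :: _ then x != z else true) & nbwalk s1]
    else true
  else true.

Lemma nbwalk_cat (s t : seq T) (x y : T) :
  nbwalk (s ++ x :: y :: t) = nbwalk (s ++ [:: x; y]) && nbwalk (x :: y :: t).
Proof.
elim: s => [|z [|z' [|z'' s]] IHs] /=.
- by rewrite !andbT; case: (e x y).
- by case: t IHs => [|t1 t] _; rewrite !andbT -!andbA; case: (e x y);
    rewrite ?andbF ?andbT.
- by move: IHs => /= ->; rewrite -!andbA.
- by move: IHs => /= ->; rewrite -!andbA.
Qed.

Lemma nbwalk_rev (s : seq T) : nbwalk (rev s) = nbwalk s.
Proof.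
elim: s => // x [|y [|z s]] // IHs; first by rewrite /rev /= e_sym.
have ->: rev [:: x, y, z & s] = rev s ++ [:: z; y; x].
  by rewrite !rev_cons -!cats1 -!catA.
rewrite nbwalk_cat.
have ->: rev s ++ [:: z; y] = rev [:: y, z & s].
  by rewrite !rev_cons -!cats1 -!catA.
rewrite IHs /= !andbT (e_sym z y) (e_sym y x) (eq_sym z x).
by case: (e y z); rewrite ?andbF //=; case: (e x y); case: (x != z);
  rewrite ?andbF ?andbT.
Qed.

Lemma nbwalk_sorted (s : seq T) : nbwalk s -> sorted e s.
Proof.
by elim: s => // x [|y s] //= IHs /and3P[-> _ /IHs].
Qed.

(** In the shortest suffix with a repetition, the stretch between the two occurrences of its head is
    a cycle. *)
Lemma nbwalk_cycle (s : seq T) :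
  nbwalk s -> ~~ uniq s -> exists2 c, graph_cycle e c & size c < size s.
Proof.
elim: s => // x s IHs nb_s; have [uniq_s|] := boolP (uniq s); last first.
  move=> /IHs[|c cP lt_c _]; last by exists c; rewrite // ltnS ltnW.
  by case: s nb_s {IHs} => // y s /and3P[].
rewrite /= uniq_s andbT negbK => x_s.
case/splitPr: x_s uniq_s nb_s => p q uniq_s nb_s.
exists (x :: p); last by rewrite /= size_cat /= addnS !ltnS leq_addr.
have := nbwalk_sorted nb_s; rewrite /= cat_path /= => /and3P[ep elast _].
apply/andP; split; last first.
  apply/andP; split; first by rewrite /= rcons_path ep.
  move: uniq_s; rewrite cat_uniq /= => /and3P[-> ].
  by rewrite negb_or => /andP[-> _].
(* The cycle has at least 3 vertices: one would give a loop, two a backtrack. *)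
case: p nb_s {ep uniq_s} elast => [|y [|z p]] //=; first by rewrite e_irr.
by rewrite eqxx andbF.
Qed.

Variable g : nat.
Hypothesis no_cycle : forall c, graph_cycle e c -> g < size c.

Lemma nbwalk_uniq (s : seq T) : nbwalk s -> size s <= g.+1 -> uniq s.
Proof.
move=> nb_s le_s; apply: contraT => /(nbwalk_cycle nb_s)[c /no_cycle]; lia.
Qed.

(** Where the walks diverge, the first reversed and followed by the second is a non-backtracking
    walk with at most [g] edges that repeats their common end. *)
Lemma nbwalk_unique (r : T) (s t : seq T) :
  nbwalk (r :: s) -> nbwalk (r :: t) -> last r s = last r t ->
  size s + size t <= g -> s = t.
Proof.
(* For the case that one walk ends before the other. *)
have closed r' s' : nbwalk (r' :: s') -> size s' <= g -> last r' s' = r' ->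
    s' = [::].
  case: s' => // y s' nb_s le_s last_s.
  have /andP[/negP[]] := nbwalk_uniq nb_s le_s.
  by rewrite -{1}last_s /= mem_last.
elim: s r t => [|x s IHs] r [|y t] //= nb_s nb_t eq_last le_st.
- by rewrite (closed r (y :: t)).
- by apply: (closed r) => //=; lia.
have [eq_xy|neq_xy] := eqVneq x y.
  rewrite -{y}eq_xy in nb_t eq_last *; congr (_ :: _).
  apply: (IHs x) => //; last lia.
  - by case/and3P: nb_s.
  - by case/and3P: nb_t.
have := @nbwalk_uniq (rev s ++ [:: x, r, y & t]).
rewrite nbwalk_cat.
have ->: rev s ++ [:: x; r] = rev [:: r, x & s].
  by rewrite !rev_cons -!cats1 -!catA.
have nb_xt : nbwalk [:: x, r, y & t].
  by rewrite /= neq_xy e_sym; case/and3P: nb_s => -> _ _.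
rewrite nbwalk_rev (nb_s : nbwalk [:: r, x & s]) nb_xt => /(_ isT).
have ->: rev s ++ [:: x, r, y & t] = rev (x :: s) ++ [:: r, y & t].
  by rewrite rev_cons -cats1 -catA.
rewrite size_cat size_rev /= => uniq_st.
have : uniq (rev (x :: s) ++ [:: r, y & t]) by apply: uniq_st; move: le_st; rewrite /=; lia.
rewrite cat_uniq => /and3P[_ /hasPn/(_ (last y t)) ].
by rewrite inE mem_last orbT mem_rev -eq_last mem_last => /(_ isT).
Qed.

End NonBacktracking.

(** * The excluded set and its two branches *)

Section Branch.

Variables (T : finType) (e : rel T).
Hypotheses (e_sym : symmetric e) (e_irr : irreflexive e).
Hypothesis deg3 : forall x, 2 < degree e x.
Hypothesis no_cycle : forall c, graph_cycle e c -> 12 < size c.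

(** Prolongs a walk ending in [p q]. Degrees of at least 3 ensure that the default [p] never
    occurs. *)
Definition next (p q : T) : T := odflt p [pick y | e q y && (y != p)].

Lemma nextP (p q : T) : e q (next p q) /\ next p q != p.
Proof.
rewrite /next; case: pickP => [y /andP[]//|none].
suff /subset_leq_card : [set y | e q y] \subset [set p].
  by rewrite cards1; have := deg3 q; rewrite /degree; lia.
apply/subsetP=> y; rewrite !inE => e_qy.
by have := none y; rewrite e_qy /= => /negbFE.
Qed.

(** [child r x] and [grandchild r x] are the chosen y and z prolonging the path [r x]. *)
Definition child (r x : T) : T := next r x.
Definition grandchild (r x : T) : T := next x (child r x).

(* The part of the excluded set hanging at the end [r] of the central path,
   [u] being the neighbour of [r] on that path. *)
Definition branch (r u : T) : {set T} :=
  [set s | [&& e u s & s != r] ||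
     [exists x, [&& e r x, x != u, e (grandchild r x) s & s != child r x]]].

(* [v] precedes [s] and [q] precedes [v] on the walk from [r] to [s]. *)
Lemma branchP (r u s : T) : e r u -> s \in branch r u ->
  exists p q v, [/\ nbwalk e (r :: rcons p s), e v q,
    (p = [:: u] /\ q = r) \/
      (exists x, [/\ p = [:: x; q; v], e r x & x != u]) & last r p = v].
Proof.
move=> e_ru; rewrite inE => /orP[/andP[e_us s_r]|/existsP[x]].
  exists [:: u], r, u; split=> //=; [|by rewrite e_sym|by left].
  by rewrite e_ru e_us eq_sym s_r.
case/and4P=> e_rx x_u e_zs s_y.
exists [:: x; child r x; grandchild r x], (child r x), (grandchild r x).
have [e_xy y_r] := nextP r x; have [e_yz z_x] := nextP x (child r x).
split=> //=; [|by rewrite e_sym|by right; exists x].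
by rewrite e_rx e_xy e_yz e_zs [r == _]eq_sym [x == _]eq_sym [_ == s]eq_sym
  y_r z_x s_y.
Qed.

Let unique (r : T) (s t : seq T) :
  nbwalk e (r :: s) -> nbwalk e (r :: t) -> last r s = last r t ->
  size s + size t <= 12 -> s = t.
Proof. exact: nbwalk_unique. Qed.

(** The walk from [r] to [s] extends to [v] unless [v] already precedes [s] on it. Then the vertex
    [q] before [v] would also lie in a branch, against the uniqueness of short walks. *)
Lemma branch_predecessor (r u b u' r' s v : T) :
    nbwalk e [:: r; u; b; u'; r'] -> s \in branch r u -> e s v ->
    {subset [set y | e v y] <= branch r u :|: branch r' u'} ->
  exists p, [/\ nbwalk e (r :: rcons (rcons p s) v) & size p <= 3].
Proof.
move=> nb_path s_in e_sv sub_v.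
have e_ru : e r u by case/and3P: nb_path.
have nb_rev : nbwalk e [:: r'; u'; b; u; r] by rewrite -nbwalk_rev.
have e_ru' : e r' u' by case/and3P: nb_rev.
have [p [q [v' [nb_p e_vq p_eq last_p]]]] := branchP e_ru s_in.
exists p; split; last by case: p_eq => [[-> _]|[x [-> _ _]]].
suff neq_v : v' != v.
  case: p_eq nb_p last_p => [[-> _]|[x [-> _ _]]] /= nb_p last_p.
    by move: nb_p; rewrite last_p e_sv neq_v /= !andbT.
  by move: nb_p; rewrite e_sv neq_v /= !andbT.
apply/eqP=> eq_v; subst v'.
have : q \in branch r u :|: branch r' u' by apply: sub_v; rewrite inE -eq_v.
rewrite inE => /orP[] /branchP.
  (* The known walk from [r] to [q] has length 0, or length 2 avoiding [u]; the branch would give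
     length 2 through [u], or length 4. *)
  case/(_ e_ru) => p' [q' [v' [nb_p' _ p'_eq _]]].
  case: p_eq nb_p => [[_ eq_q]|[x [-> e_rx x_u]]] nb_p.
    have := @unique r [::] (rcons p' q) isT nb_p'.
    rewrite last_rcons eq_q => /(_ erefl).
    by case: p'_eq => [[-> _]|[x [-> _ _]]] /= => /(_ isT).
  have := @unique r [:: x; q] (rcons p' q) _ nb_p'.
  have -> : nbwalk e [:: r; x; q] by case/and4P: nb_p => /= -> -> ->.
  rewrite last_rcons => /(_ isT erefl).
  case: p'_eq => [[-> _]|[y [-> _ _]]] /= => /(_ isT) [] // eq_x.
  by rewrite eq_x eqxx in x_u.
(* The central path leads from [r'] to [q] in 4 or 6 steps; the branch would give length 2, or
   length 4 avoiding [u']. *)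
case/(_ e_ru') => p' [q' [v' [nb_p' _ p'_eq _]]].
case: p_eq nb_p => [[_ eq_q]|[x [-> e_rx x_u]]] nb_p.
  have := @unique r' [:: u'; b; u; r] (rcons p' q) nb_rev nb_p'.
  rewrite last_rcons eq_q => /(_ erefl).
  case: p'_eq => [[-> _]|[y [-> _ y_u]]] /= => /(_ isT) [] // eq_y.
  by rewrite eq_y eqxx in y_u.
have := @unique r' [:: u'; b; u; r; x; q] (rcons p' q) _ nb_p'.
have -> : nbwalk e [:: r'; u'; b; u; r; x; q].
  rewrite (@nbwalk_cat _ _ [:: r'; u'; b] [:: x; q]) nb_rev /=.
  move: nb_p => /= /and4P[-> -> -> _].
  by rewrite e_sym e_ru eq_sym x_u.
rewrite last_rcons => /(_ isT erefl).
by case: p'_eq => [[-> _]|[y [-> _ _]]] /= => /(_ isT).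
Qed.

(** Two walks from [r] to [v] of length at most 5 coincide, so their vertices before [v] agree. *)
Lemma branch_neighbour_unique (r u b u' r' s t v : T) :
    nbwalk e [:: r; u; b; u'; r'] ->
    {subset [set y | e v y] <= branch r u :|: branch r' u'} ->
    s \in branch r u -> t \in branch r u -> e v s -> e v t ->
  s = t.
Proof.
move=> nb_path sub_v s_in t_in e_vs e_vt; rewrite e_sym in e_vs.
rewrite e_sym in e_vt.
have [p [nb_p le_p]] := branch_predecessor nb_path s_in e_vs sub_v.
have [q [nb_q le_q]] := branch_predecessor nb_path t_in e_vt sub_v.
have := unique nb_p nb_q; rewrite !last_rcons !size_rcons => /(_ erefl).
have -> : (size p).+2 + (size q).+2 <= 12 by lia.
by move=> /(_ isT)/rcons_inj[/rcons_inj[]].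
Qed.

(** Each branch would hold at most one of the three or more neighbours of [v]. *)
Lemma branches_contain_no_neighbourhood (a u b w c v : T) :
    nbwalk e [:: a; u; b; w; c] ->
  ~~ ([set y | e v y] \subset branch a u :|: branch c w).
Proof.
move=> nb_path; apply/negP=> /subsetP sub_v.
have nb_rev : nbwalk e [:: c; w; b; u; a] by rewrite -nbwalk_rev.
have sub_v' : {subset [set y | e v y] <= branch c w :|: branch a u}.
  by move=> y /sub_v; rewrite setUC.
have few r u' b' w' r' : nbwalk e [:: r; u'; b'; w'; r'] ->
    {subset [set y | e v y] <= branch r u' :|: branch r' w'} ->
    #|[set y | e v y] :&: branch r u'| <= 1.
  move=> nb_r sub_r; apply/card_le1_eqP => s t.
  rewrite !inE => /andP[e_vs s_in] /andP[e_vt t_in].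
  by apply: (branch_neighbour_unique nb_r sub_r); rewrite // inE.
have := deg3 v; rewrite /degree.
have /setIidPl <- : [set y | e v y] \subset branch a u :|: branch c w.
  exact/subsetP.
rewrite setIUr => deg_v.
have := (leq_card_setU ([set y | e v y] :&: branch a u)
  ([set y | e v y] :&: branch c w)).1.
have := few _ _ _ _ _ nb_path sub_v; have := few _ _ _ _ _ nb_rev sub_v'; lia.
Qed.

(* A TDS avoiding the branch at [r] must contain [r] and every [child r x], so
   the latter take over the domination of the neighbours [x] of [r]. *)
Lemma avoiding_branch (S : {set T}) (r u : T) :
    e r u -> total_dominating e S -> [disjoint S & branch r u] ->
  r \in S /\ forall x, e r x -> x != u -> child r x \in S.
Proof.
move=> e_ru /forallP domS disj; split=> [|x e_rx x_u].
  have /exists_inP[s sS e_us] := domS u.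
  have [<- //|s_r] := eqVneq s r.
  by have := disjointFr disj sS; rewrite inE e_us s_r.
have /exists_inP[s sS e_zs] := domS (grandchild r x).
have [<- //|s_y] := eqVneq s (child r x).
have /negbT := disjointFr disj sS; rewrite inE negb_or => /andP[_ /negP[]].
by apply/existsP; exists x; rewrite e_rx x_u e_zs s_y.
Qed.

(** Equality with [r'] would give a walk of length 2 besides the central one of length 4. Hence
    these children survive the removal of both ends. *)
Lemma child_neq_end (r u b u' r' x : T) :
    nbwalk e [:: r; u; b; u'; r'] -> e r x ->
  child r x != r /\ child r x != r'.
Proof.
move=> nb_path e_rx; have [e_xy y_r] := nextP r x.
split=> //; apply/eqP => eq_y.
have := @unique r [:: x; r'] [:: u; b; u'; r'] _ nb_path erefl isT.
rewrite -eq_y.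
by rewrite /= e_rx e_xy eq_sym y_r => /(_ isT).
Qed.

(** * The exchange of two vertices for one *)

Lemma not_well_totally_dominated : 0 < #|T| -> ~ well_totally_dominated e.
Proof.
case/card_gt0P => b _ [_ same_size].
have [u e_bu] : exists u, e b u.
  have : 0 < #|[set y | e b y]| by apply: ltn_trans (deg3 b).
  by case/card_gt0P => u; rewrite inE => e_bu; exists u.
pose w := next u b; pose a := next b u; pose c := next b w.
have [e_bw w_u] : e b w /\ w != u by apply: nextP.
have [e_ua a_b] : e u a /\ a != b by apply: nextP.
have [e_wc c_b] : e w c /\ c != b by apply: nextP.
have nb_path : nbwalk e [:: a; u; b; w; c].
  by rewrite /= e_bw e_wc a_b [e a u]e_sym [e u b]e_sym e_ua e_bu
    [u == w]eq_sym [b == c]eq_sym w_u c_b.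
have nb_rev : nbwalk e [:: c; w; b; u; a] by rewrite -nbwalk_rev.
have e_au : e a u by rewrite e_sym.
have e_cw : e c w by rewrite e_sym.
have a_c : a != c.
  apply/eqP => eq_ac; have := unique (s := [::]) isT nb_path.
  by rewrite /= -eq_ac => /(_ erefl isT).
pose I := branch a u :|: branch c w.
have domI : total_dominating e (~: I).
  apply/forallP=> v.
  have /subsetPn[y] := branches_contain_no_neighbourhood v nb_path.
  by rewrite inE => e_vy y_I; apply/exists_inP; exists y; rewrite // inE.
have [S minS sSI] := minset_exists domI.
have domS := minsetp minS.
have disj : [disjoint S & I] by rewrite -[I]setCK -subsets_disjoint.
have [aS childa] : a \in S /\ forall x, e a x -> x != u -> child a x \in S.
  apply: avoiding_branch => //.
  by apply: disjointWr disj; apply: subsetUl.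
have [cS childc] : c \in S /\ forall x, e c x -> x != w -> child c x \in S.
  apply: avoiding_branch => //.
  by apply: disjointWr disj; apply: subsetUr.
(* As a neighbour of [u] other than [a], [b] lies in the branch at [a]. *)
have bS : b \notin S.
  apply/negP=> bS; have := disjointFr disj bS.
  by rewrite !inE e_sym e_bu eq_sym a_b.
pose S' := b |: (S :\ a) :\ c.
have domS' : total_dominating e S'.
  apply/forallP=> v; apply/exists_inP.
  have [e_vb|nvb] := boolP (e v b); first by exists b; rewrite // !inE eqxx.
  have /exists_inP[s sS e_vs] := forallP domS v.
  (* A vertex [v] that relied on [a] is not adjacent to [b], so it differs from [u] and [child a v]
     dominates it; likewise for [c]. *)
  have [eq_s|s_a] := eqVneq s a.
    rewrite {s sS}eq_s e_sym in e_vs.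
    have [y_a y_c] := child_neq_end nb_path e_vs.
    exists (child a v); last by have [] := nextP a v.
    rewrite !inE y_a y_c childa ?orbT //.
    by apply: contraNneq nvb => ->; rewrite e_sym.
  have [eq_s|s_c] := eqVneq s c.
    rewrite {s sS s_a}eq_s e_sym in e_vs.
    have [y_c y_a] := child_neq_end nb_rev e_vs.
    exists (child c v); last by have [] := nextP c v.
    rewrite !inE y_a y_c childc ?orbT //.
    by apply: contraNneq nvb => ->; rewrite e_sym.
  by exists s; rewrite // !inE s_a s_c sS orbT.
(* [S'] has one element fewer than [S], too few to contain a minimal TDS of the size of [S]. *)
have [S2 minS2 sS2] := minset_exists domS'.
have := subset_leq_card sS2; rewrite -(same_size _ _ minS minS2).
rewrite cardsU1 (cardsD1 a S) aS (cardsD1 c (S :\ a)) !inE cS eq_sym a_c /=.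
by rewrite (negbTE bS) !andbF /= !add1n ltnn.
Qed.

End Branch.

(** * The bound on the girth *)

Theorem theorem4p3 (T : finType) (e : rel T)
    (T_nonempty : 0 < #|T|)
    (e_simple : simple_graph e)
    (e_wtd : well_totally_dominated e)
    (min_deg3 : 3 <= min_degree e) :
  exists2 g : nat, girth e = Some g & g <= 12.
Proof.
have [e_sym e_irr] := e_simple.
have deg3 : forall x, 2 < degree e x by apply/min_degreeP.
(* A cycle of length at most 12 bounds the girth; without one, all cycles are longer than 12 and the
   exchange gives a contradiction. *)
have [/existsP[k has_k]|none] :=
    boolP [exists k : 'I_13, has_cycle_of_length e k].
  have [c cP size_c] : exists2 c, graph_cycle e c & size c = k.
    by case/existsP: has_k => c cP; exists (val c); rewrite ?size_tuple.
  have : exists g, girth e = Some g.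
    rewrite /girth; case eq_s: [seq _ <- _ | _] => [|g s]; last by exists g.
    have : nat_of_ord k \in [seq k <- iota 0 #|T|.+1 | has_cycle_of_length e k].
      rewrite mem_filter has_k mem_iota add0n ltnS -size_c.
      by case/and3P: cP => _ _ /card_uniqP <-; apply: max_card.
    by rewrite eq_s.
  case=> g girth_g; exists g => //.
  have [_ /(_ _ cP)] := (girthP e g).1 girth_g.
  by rewrite size_c => le_g; apply: leq_trans le_g _; rewrite -ltnS.
case: (not_well_totally_dominated e_sym e_irr deg3 _ T_nonempty e_wtd) => c cP.
rewrite ltnNge; apply: contra none => le_c; apply/existsP.
by exists (Ordinal (le_c : size c < 13)); apply/existsP; exists (in_tuple c).
Qed.
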